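(* For each self-delimiting Turing machine $C$ there effectively exists a tuatara machine $V$ such that $\zeta_V=\Omega_C$.
   Context: Turing machines map binary strings to binary strings (partial functions on $\Sigma^*$, $\Sigma=\{0,1\}$); $\mathrm{dom}(M)$ is the set of inputs on which $M$ halts; $M$ is self-delimiting if $\mathrm{dom}(M)$ is prefix-free. $\mathrm{bin}:\mathbf{N}=\{1,2,\dots\}\to\Sigma^*$ is the bijection sending $n$ to its binary expansion with the leading 1 removed. $\Omega_M=\sum_{p\in\mathrm{dom}(M)}2^{-|p|}$, $\zeta_M=\sum_{n\ge1,\ \mathrm{bin}(n)\in\mathrm{dom}(M)}\frac1n$. $M$ is a tuatara machine if $\zeta_M\le1$. *)

(* Defs.v *)
From Corelib Require Import BinNums.
From mathcomp Require Import all_boot all_order all_algebra.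
From mathcomp Require Import all_classical all_reals all_analysis.

Set Implicit Arguments.
Unset Strict Implicit.
Unset Printing Implicit Defensive.


Local Open Scope classical_set_scope.
Local Open Scope ring_scope.

Definition bstring := seq bool.

(* Deterministic one-tape Turing machines, given by a finite table of
   quintuples. States and tape symbols are natural numbers, of which a table
   mentions only finitely many: the state set and the tape alphabet of a
   machine are finite but arbitrary. The initial state is 0; the symbol 0 is
   the blank, 1 and 2 stand for the bits 0 and 1, and larger symbols are
   auxiliary. *)
Inductive move := MoveLeft | MoveRight | Stay.

Record instr := Instr {
  src : nat; scanned : nat;
  dst : nat; written : nat; dir : move }.

Definition turing := seq instr.

Definition blank : nat := 0%N.
Definition bit_symbol (b : bool) : nat := if b then 2%N else 1%N.

(* A tape that is infinite in both directions: [left_of] lists the cells to the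
   left of the head starting from the nearest one, [right_of] those to the
   right; all cells beyond the two lists are blank. *)
Record tape := Tape { left_of : seq nat; under : nat; right_of : seq nat }.

Definition move_head (d : move) (t : tape) : tape :=
  let: Tape l a r := t in
  match d with
  | MoveLeft => Tape (behead l) (head blank l) (a :: r)
  | MoveRight => Tape (a :: l) (head blank r) (behead r)
  | Stay => t
  end.

Record config := Config { state : nat; tape_of : tape }.

Definition applicable (c : config) (i : instr) : bool :=
  (src i == state c) && (scanned i == under (tape_of c)).

(* The first applicable instruction is the one executed, so that every table
   is deterministic; the machine halts when no instruction is applicable. *)
Definition step (M : turing) (c : config) : option config :=
  if ohead [seq i <- M | applicable c i] is Some i then
    let: Tape l _ r := tape_of c in
    Some (Config (dst i) (move_head (dir i) (Tape l (written i) r)))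
  else None.

(* The head starts on the first symbol of the input. *)
Definition init (x : bstring) : config :=
  let s := map bit_symbol x in
  Config 0%N (Tape [::] (head blank s) (behead s)).

Fixpoint read_bits (s : seq nat) : bstring :=
  match s with
  | 1%N :: s' => false :: read_bits s'
  | 2%N :: s' => true :: read_bits s'
  | _ => [::]
  end.

(* The output is the longest string of bits starting at the head. *)
Definition output (c : config) : bstring :=
  read_bits (under (tape_of c) :: right_of (tape_of c)).

Definition steps (M : turing) (n : nat) (c : config) : option config :=
  iter n (obind (step M)) (Some c).

Definition computes (M : turing) (x y : bstring) : Prop :=
  exists n c, [/\ steps M n (init x) = Some c, step M c = None & output c = y].

Definition dom (M : turing) : set bstring := [set x | exists y, computes M x y].

(* Descriptions of machines as binary strings: each number n is written
   1^n 0, and an instruction is written as five such numbers. *)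
Definition code_nat (n : nat) : bstring := rcons (nseq n true) false.

Definition code_move (d : move) : bstring :=
  code_nat (match d with MoveLeft => 0%N | MoveRight => 1%N | Stay => 2%N end).

Definition code_instr (i : instr) : bstring :=
  code_nat (src i) ++ code_nat (scanned i) ++
  code_nat (dst i) ++ code_nat (written i) ++ code_move (dir i).

Definition code (M : turing) : bstring := flatten (map code_instr M).

Lemma code_nat_inj m n s t :
  code_nat m ++ s = code_nat n ++ t -> m = n /\ s = t.
Proof.
elim: m n => [|m IH] [|n] //=; first by case=> ->.
by case=> /IH [-> ->].
Qed.

Lemma code_instr_inj i j s t :
  code_instr i ++ s = code_instr j ++ t -> i = j /\ s = t.
Proof.
case: i j => [a b c d e] [a' b' c' d' e']; rewrite /code_instr /= -!catA.
do 4![move=> /code_nat_inj [->]]; move=> /code_nat_inj [+ ->].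
by case: e e' => [] [].
Qed.

Lemma code_inj : injective code.
Proof.
have code_cons i M : code (i :: M) <> [::] by case: i => [[|?] ? ? ? ?].
elim=> [|i M IH] [|j N] //; first by move/esym/code_cons.
  by move/code_cons.
by rewrite /code /= => /code_instr_inj [-> /IH ->].
Qed.

Definition self_delimiting (M : turing) : Prop :=
  forall p q : bstring, dom M p -> dom M q -> prefix p q -> p = q.

(* The binary expansion without its leading 1; the constructor [xH] of
   [positive] is that leading 1. *)
Fixpoint bin_pos (p : positive) : bstring :=
  match p with
  | xH => [::]
  | xO q => rcons (bin_pos q) false
  | xI q => rcons (bin_pos q) true
  end.

(* Only meaningful for n >= 1; the value at 0 is junk. *)
Definition bin (n : nat) : bstring :=
  if bin_of_nat n is Npos p then bin_pos p else [::].

(* Sums of nonnegative terms in the extended reals, possibly +oo. *)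
Definition Omega (R : realType) (M : turing) : \bar R :=
  \esum_(p in dom M) (2 ^- size p)%:E.

Definition zeta (R : realType) (M : turing) : \bar R :=
  \esum_(n in [set n : nat | (1 <= n)%N /\ dom M (bin n)]) (n%:R^-1)%:E.

Definition tuatara (R : realType) (M : turing) : Prop := (zeta R M <= 1)%E.

(* Main.v *)
(** Let [c] be the number with binary expansion [1 y 1], of [l + 1] digits, where
    [l = |y| + 1]. Reading [c / 2^l] digit by digit, the sum of [1 / (c 2^e)]
    over the [e] such that the [e]-th leading digit of [c] (from 0) is 1 equals
    [c 2^-l / c = 2^-l]. As [c] is odd, the numbers [c 2^e] are pairwise
    distinct; in the notation of [bin] they are the strings [y 1 0^e].

    Let [V] map such a string to the prefix [p] of [y] of length [|y|/2], run
    [C] on [p], and diverge on all other strings. A given [p] of length [k] is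
    reached from [2^k] strings [y] of length [2k] and [2^(k+1)] of length
    [2k+1], so it contributes
    [2^k 2^-(2k+1) + 2^(k+1) 2^-(2k+2) = 2^-k] to the zeta number of [V]. Hence
    [zeta_V = Omega_C], and [Omega_C <= 1] by Kraft's inequality.

    [V] first runs a fixed table that computes [p] in place, then [C] with its
    states shifted, so [code V] is obtained from [code C] by inserting a fixed
    number of ones into every state field and appending a constant. *)

From HB Require Import structures.
From mathcomp Require Import all_boot all_order all_algebra.
From mathcomp Require Import all_classical all_reals all_analysis.
From mathcomp Require Import ring lra.
Require Import Defs.

Set Implicit Arguments.
Unset Strict Implicit.
Unset Printing Implicit Defensive.

Import Order.TTheory GRing.Theory Num.Theory.

(** * Runs of Turing machines *)

(** This is [computes] from an arbitrary configuration, so that a run can be rewritten step by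
    step. *)
Definition yields (M : turing) (c : config) (y : bstring) : Prop :=
  exists n c', [/\ steps M n c = Some c', step M c' = None & output c' = y].

Lemma iter_step_none M n : iter n (obind (step M)) None = None.
Proof. by elim: n => //= n ->. Qed.

(** Determinism makes this an equivalence, so the simulations below give divergence along with
    convergence. *)
Lemma yields_step M c c' y :
  step M c = Some c' -> yields M c y <-> yields M c' y.
Proof.
move=> cc'; have stepsS n : steps M n.+1 c = steps M n c'.
  by rewrite /steps iterSr /= cc'.
split=> [[[|n] [d [cd dN dy]]]|[n [d [cd dN dy]]]].
- by case: cd dN => <-; rewrite cc'.
- by exists n, d; rewrite -stepsS.
- by exists n.+1, d; rewrite stepsS.
Qed.

Lemma yields_halted M c y :
  step M c = None -> yields M c y <-> output c = y.
Proof.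
move=> cN; split=> [[[|n] [d [cd dN dy]]]|cy]; last by exists 0, c.
  by case: cd => ->.
by move: cd; rewrite /steps iterSr /= cN iter_step_none.
Qed.

Lemma loop_diverges M c y : step M c = Some c -> ~ yields M c y.
Proof.
move=> cc [n [d [cd dN _]]]; have : steps M n c = Some c.
  by rewrite /steps; elim: n {cd} => //= n ->.
by rewrite cd => -[dc]; rewrite dc cc in dN.
Qed.

(** * Configurations up to trailing blanks *)

Definition same_cells (s t : seq nat) := nth blank s =1 nth blank t.

Definition same_config (c d : config) :=
  [/\ state c = state d,
      same_cells (left_of (tape_of c)) (left_of (tape_of d)),
      under (tape_of c) = under (tape_of d) &
      same_cells (right_of (tape_of c)) (right_of (tape_of d))].

Lemma same_cells_cons a s t : same_cells s t -> same_cells (a :: s) (a :: t).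
Proof. by move=> st [|i] /=. Qed.

Lemma same_cells_behead s t :
  same_cells s t -> same_cells (behead s) (behead t).
Proof. by move=> st i; rewrite !nth_behead. Qed.

Lemma same_cells_head s t : same_cells s t -> head blank s = head blank t.
Proof. by move/(_ 0); rewrite !nth0. Qed.

Lemma same_cells_trail s n : same_cells (s ++ nseq n blank) s.
Proof.
move=> i; rewrite nth_cat nth_nseq; case: ltnP => // si.
by rewrite (nth_default _ si) if_same.
Qed.

Lemma read_bits_same s t : same_cells s t -> read_bits s = read_bits t.
Proof.
elim: s t => [|a s IH] [|b t] // st.
- by move: (st 0) => /= <-.
- by move: (st 0) => /= ->.
- have /= ab := st 0; have /IH -> : same_cells s t by move=> i; exact: (st i.+1).
  by rewrite ab.
Qed.

Lemma output_same c d : same_config c d -> output c = output d.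
Proof.
case=> _ _ cd rcd; apply: read_bits_same.
by rewrite cd; apply: same_cells_cons.
Qed.

Lemma move_same d l l' a r r' q : same_cells l l' -> same_cells r r' ->
  same_config (Config q (move_head d (Tape l a r)))
              (Config q (move_head d (Tape l' a r'))).
Proof.
move=> ll rr; case: d; split=> //=.
- exact: same_cells_behead.
- exact: same_cells_head.
- exact: same_cells_cons.
- exact: same_cells_cons.
- exact: same_cells_head.
- exact: same_cells_behead.
Qed.

Lemma step_same M c d : same_config c d ->
  match step M c, step M d with
  | Some c', Some d' => same_config c' d'
  | None, None => True
  | _, _ => False
  end.
Proof.
case: c d => [q [l a r]] [q' [l' a' r']] [/= <- ll <- rr]; rewrite /step /=.
rewrite (@eq_filter _ _ (applicable (Config q (Tape l' a r')))) //.
by case: ohead => // i; apply: move_same.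
Qed.

Lemma yields_same M c d y : same_config c d -> yields M c y <-> yields M d y.
Proof.
suff imp c' d' : same_config c' d' -> yields M c' y -> yields M d' y.
  move=> cd; split; apply: imp => //; case: cd => ? ? ? ?; split=> // i.
move=> cd [n [e [ce eN ey]]]; elim: n c' d' cd ce => [|n IH] c' d' cd.
  case=> ce; move: (step_same M cd); rewrite ce eN => dN.
  exists 0, d'; split=> //; first by case: step dN.
  by rewrite -(output_same cd) ce.
rewrite /steps iterSr /=.
move: (step_same M cd); case c'E: (step M c') => [c1|]; last first.
  by move=> _; rewrite iter_step_none.
case d'E: (step M d') => [d1|] // cd1 ce.
by apply/(yields_step _ d'E); apply: IH ce.
Qed.

(* [focus l r] has the head on the first cell of [r]; [focus_left l r] has it
   on the first cell of [l], i.e. it is [focus l r] after a move to the left. *)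
Definition focus (l r : seq nat) : tape := Tape l (head blank r) (behead r).
Definition focus_left (l r : seq nat) : tape :=
  focus (behead l) (head blank l :: r).

Lemma yields_tape M q l l' a a' r r' y :
  same_cells l l' -> a = a' -> same_cells r r' ->
  yields M (Config q (Tape l a r)) y <-> yields M (Config q (Tape l' a' r')) y.
Proof. by move=> ll aa rr; apply: yields_same; split. Qed.

Lemma yields_focus M q l l' r r' y : same_cells l l' -> same_cells r r' ->
  yields M (Config q (focus l r)) y <-> yields M (Config q (focus l' r')) y.
Proof.
move=> ll rr; apply: yields_tape => //; first exact: same_cells_head.
exact: same_cells_behead.
Qed.

Lemma walk_right M q w l r y :
  (forall l' a r', a \in w -> step M (Config q (Tape l' a r')) =
     Some (Config q (move_head MoveRight (Tape l' a r')))) ->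
  yields M (Config q (focus l (w ++ r))) y <->
  yields M (Config q (focus (rev w ++ l) r)) y.
Proof.
elim: w l => [|a w IH] l H //=.
rewrite rev_cons cat_rcons -IH; last first.
  by move=> l' b r' bw; apply: H; rewrite inE bw orbT.
by apply: yields_step; rewrite H ?mem_head.
Qed.

(** Induction from the right end of [w], which the head meets first; [g] allows the symbols to be
    rewritten on the way. *)
Lemma walk_left M q g w l r y :
  (forall l' a r', a \in w -> step M (Config q (Tape l' a r')) =
     Some (Config q (move_head MoveLeft (Tape l' (g a) r')))) ->
  yields M (Config q (focus_left (rev w ++ l) r)) y <->
  yields M (Config q (focus_left l (map g w ++ r))) y.
Proof.
elim/last_ind: w r => [|w a IH] r H //=.
rewrite rev_rcons map_rcons cat_rcons -IH; last first.
  by move=> l' b r' bw; apply: H; rewrite mem_rcons inE bw orbT.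
by apply: yields_step; rewrite /focus_left /focus /= H // mem_rcons mem_head.
Qed.

(** * Tables of finite programs, and machines run after them *)

(* A program on a finite set of states; the target [None] means exit. It is
   turned into a table for the tape symbols below [K], with the exit numbered
   [exit_state S], just above the codes of the states. *)
Definition program (S : finType) := S -> nat -> option S * nat * move.

Definition exit_state (S : finType) : nat := #|S|.+1.

(** Prepending [s0] gives the start state the number 0, as [init] requires; [index] picks first
    occurrences, so the codes stay distinct. *)
Definition encode (S : finType) (s0 : S) (o : option S) : nat :=
  if o is Some s then index s (s0 :: enum S) else exit_state S.

Definition table (S : finType) (s0 : S) (delta : program S) (K : nat) : turing :=
  [seq let: (o, b, d) := delta p.1 p.2 in
       Instr (encode s0 (Some p.1)) p.2 (encode s0 o) b d
  | p <- [seq (s, a) | s <- enum S, a <- iota 0 K]].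

Arguments encode : simpl never.

Lemma encode_lt (S : finType) (s0 s : S) :
  encode s0 (Some s) < exit_state S.
Proof.
have : s \in s0 :: enum S by rewrite inE mem_enum orbT.
by rewrite -index_mem /= -cardE.
Qed.

Lemma encode_inj (S : finType) (s0 s t : S) :
  (encode s0 (Some s) == encode s0 (Some t)) = (s == t).
Proof.
have H u : nth s0 (s0 :: enum S) (encode s0 (Some u)) = u.
  by apply: nth_index; rewrite inE mem_enum orbT.
by apply/eqP/eqP => [|->//]; move/(congr1 (nth s0 (s0 :: enum S))); rewrite !H.
Qed.

Lemma encode_start (S : finType) (s0 : S) : encode s0 (Some s0) = 0.
Proof. by rewrite /encode /= eqxx. Qed.

Lemma applicable_below (S : finType) (P : turing) q t :
  all (fun i => exit_state S <= src i) P -> q < exit_state S ->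
  [seq i <- P | applicable (Config q t) i] = [::].
Proof.
elim: P => [|i P IH] //= /andP[iS PS] qS; rewrite IH // /applicable /=.
by case: eqP => // iq; move: qS; rewrite -iq ltnNge iS.
Qed.

(** No instruction of [P] applies below the exit state, and the table lists the pair [(s, a)]
    exactly once. *)
Lemma step_table (S : finType) (s0 : S) (delta : program S) K P s l a r :
  all (fun i => exit_state S <= src i) P -> a < K ->
  step (P ++ table s0 delta K) (Config (encode s0 (Some s)) (Tape l a r)) =
  let: (o, b, d) := delta s a in
  Some (Config (encode s0 o) (move_head d (Tape l b r))).
Proof.
move=> PS aK; rewrite /step filter_cat (applicable_below _ PS) ?encode_lt //.
rewrite cat0s filter_map.
rewrite (@eq_filter _ _ (pred1 (s, a))) => [|[t b]]; last first.
  rewrite /= /applicable; case: (delta t b) => -[tgt b1] d /=.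
  by rewrite encode_inj xpair_eqE.
rewrite filter_pred1_uniq.
- by rewrite /=; case: (delta s a) => -[tgt b1] d.
- apply: (@allpairs_uniq _ _ _ pair); rewrite ?enum_uniq ?iota_uniq //.
  by move=> [? ?] [? ?].
- by rewrite allpairs_f // ?mem_enum // mem_iota.
Qed.

Lemma step_table_exit (S : finType) (s0 : S) (delta : program S) K q t :
  exit_state S <= q -> [seq i <- table s0 delta K | applicable (Config q t) i] = [::].
Proof.
move=> Sq; rewrite filter_map (@eq_filter _ _ pred0) ?filter_pred0 //.
move=> [s a] /=; rewrite /applicable.
case: (delta s a) => -[tgt b] d /=.
by rewrite (ltn_eqF (leq_trans (encode_lt _ _) Sq)).
Qed.

Definition shift_instr (N : nat) (i : instr) : instr :=
  Instr (N + src i) (scanned i) (N + dst i) (written i) (dir i).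

Definition shift_config (N : nat) (c : config) : config :=
  Config (N + state c) (tape_of c).

(** From the exit on, only the shifted copy of [C] can act. The exit number is the image of state 0
    of [C], so leaving the table starts [C]. *)
Lemma step_shift (S : finType) (s0 : S) (delta : program S) K C c :
  step (map (shift_instr (exit_state S)) C ++ table s0 delta K)
       (shift_config (exit_state S) c) =
  omap (shift_config (exit_state S)) (step C c).
Proof.
case: c => q [l a r]; rewrite /step filter_cat step_table_exit ?leq_addr // cats0.
rewrite filter_map (@eq_filter _ _ (applicable (Config q (Tape l a r)))).
  by case: [seq _ <- C | _].
by move=> i; rewrite /applicable /= eqn_add2l.
Qed.

Lemma yields_shift (S : finType) (s0 : S) (delta : program S) K C c y :
  yields (map (shift_instr (exit_state S)) C ++ table s0 delta K)
         (shift_config (exit_state S) c) y <-> yields C c y.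
Proof.
set M := _ ++ _; have stepsE n d : steps M n (shift_config (exit_state S) d) =
    omap (shift_config (exit_state S)) (steps C n d).
  rewrite /steps; elim: n => //= n ->.
  by case: (iter n _ _) => //= e; rewrite step_shift.
split=> -[n [d [cd dN dy]]]; last first.
  exists n, (shift_config (exit_state S) d).
  by rewrite stepsE cd /M step_shift dN.
move: cd; rewrite stepsE; case E: (steps C n c) => [e|] //= [ed].
exists n, e; rewrite E; move: dN dy; rewrite -ed /M step_shift.
by case: (step C e).
Qed.

(** * The machine that extracts the first half of [y] from [y 1 0^e] *)

(** A round finds the right end ([Seek]), tests and erases the last symbol ([Test]), returns
    ([Back]) and marks the first unmarked symbol ([Mark]). [Unmark] restores the bits and [Reject]
    loops; the boolean flag is [true] in the phase that matches zeros. *)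
Inductive fold_state :=
  | Seek of option bool | Test of option bool
  | Back of bool | Mark of bool | Unmark of bool | Reject.

Definition fold_state_code (s : fold_state) :
    option bool + option bool + (bool + bool + (bool + unit)) :=
  match s with
  | Seek ph => inl (inl ph) | Test ph => inl (inr ph)
  | Back x => inr (inl (inl x)) | Mark x => inr (inl (inr x))
  | Unmark x => inr (inr (inl x)) | Reject => inr (inr (inr tt))
  end.

Definition fold_state_decode
    (s : option bool + option bool + (bool + bool + (bool + unit))) :=
  match s with
  | inl (inl ph) => Seek ph | inl (inr ph) => Test ph
  | inr (inl (inl x)) => Back x | inr (inl (inr x)) => Mark x
  | inr (inr (inl x)) => Unmark x | inr (inr (inr _)) => Reject
  end.

Lemma fold_state_codeK : cancel fold_state_code fold_state_decode.
Proof. by case. Qed.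

HB.instance Definition _ := Finite.copy fold_state (can_type fold_state_codeK).

Definition marked (b : bool) : nat := (bit_symbol b).+2.

Definition unmark (a : nat) : nat := if 2 < a then a.-2 else a.

Definition is_bit (a : nat) : bool := (a == 1) || (a == 2).

(* Phase [Some b] matches the trailing zeros of the input with its first
   symbols, [b] being the last symbol matched; phase [None] matches the symbols
   of the second half of the remaining word with those of the first half. *)
Definition fold_program : program fold_state := fun s a =>
  match s with
  | Seek ph => if a == blank then (Some (Test ph), blank, MoveLeft)
               else (Some (Seek ph), a, MoveRight)
  | Test None => if is_bit a then (Some (Back false), blank, MoveLeft)
                 else (Some (Unmark false), a, Stay)
  | Test (Some b) =>
      if a == bit_symbol false then (Some (Back true), blank, MoveLeft)
      else if (a == bit_symbol true) && b || (a == marked true)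
      then (Some (Unmark true), blank, MoveLeft)
      else (Some Reject, a, Stay)
  | Back x => if is_bit a then (Some (Back x), a, MoveLeft)
              else (Some (Mark x), a, MoveRight)
  | Mark x => if is_bit a
              then (Some (Seek (if x then Some (a == 2) else None)), a.+2,
                    MoveRight)
              else if x then (Some Reject, a, Stay)
              else (Some (Unmark false), a, MoveLeft)
  | Unmark x => if a == blank
                then (if x then Some (Seek None) else None, blank, MoveRight)
                else (Some (Unmark x), unmark a, MoveLeft)
  | Reject => (Some Reject, a, Stay)
  end.

(** [Some true] is the leading 1 of [c], which [bin] drops: it is digit 0, the one tested when there
    is no trailing zero. *)
Definition fold_start := Seek (Some true).

Definition fold_exit := exit_state fold_state.

Definition folding (C : turing) : turing :=
  map (shift_instr fold_exit) C ++ table fold_start fold_program 5.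

Definition fold_config (s : fold_state) := Config (encode fold_start (Some s)).

Definition bits (w : bstring) : seq nat := map bit_symbol w.
Definition marks (w : bstring) : seq nat := map marked w.

Lemma bits_rcons w b : bits (rcons w b) = rcons (bits w) (bit_symbol b).
Proof. exact: map_rcons. Qed.

Lemma marks_rcons w b : marks (rcons w b) = rcons (marks w) (marked b).
Proof. exact: map_rcons. Qed.

Lemma step_folding C s l a r : a < 5 ->
  step (folding C) (fold_config s (Tape l a r)) =
  let: (o, b, d) := fold_program s a in
  Some (Config (encode fold_start o) (move_head d (Tape l b r))).
Proof.
by move=> a5; apply: step_table => //; elim: C => //= i C ->; rewrite leq_addr.
Qed.

Lemma yields_folding C s l a r y : a < 5 ->
  yields (folding C) (fold_config s (Tape l a r)) y <->
  let: (o, b, d) := fold_program s a in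
  yields (folding C)
    (Config (encode fold_start o) (move_head d (Tape l b r))) y.
Proof.
move=> a5; have := step_folding C s l r a5.
by case: fold_program => -[tgt b] d; apply: yields_step.
Qed.

Lemma marked_lt5 b : marked b < 5. Proof. by case: b. Qed.
Lemma bit_lt5 b : bit_symbol b < 5. Proof. by case: b. Qed.
Lemma is_bit_symbol b : is_bit (bit_symbol b). Proof. by case: b. Qed.

(* The configuration at the start of each round: the first [size u] symbols
   have been marked, and as many symbols erased on the right. *)
Definition round_config ph u w :=
  fold_config (Seek ph) (focus (rev (marks u)) (bits w)).

Lemma seek_end C ph u w y :
  yields (folding C) (round_config ph u w) y <->
  yields (folding C)
    (fold_config (Test ph) (focus_left (rev (marks u ++ bits w)) [::])) y.
Proof.
rewrite /round_config -[bits w]cats0 /fold_config walk_right; last first.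
  move=> l a r /mapP[b _ ->]; rewrite -/(fold_config _ _) step_folding ?bit_lt5 //.
  by case: b.
rewrite -/(fold_config _ _) yields_folding //= -/(fold_config _ _).
rewrite cats0 -rev_cat /focus_left /=.
by apply: yields_tape => //; exact: (same_cells_trail [::] 1).
Qed.

Lemma back_to_mark C x u w r y :
  yields (folding C)
    (fold_config (Back x) (focus_left (rev (marks u ++ bits w)) r)) y <->
  yields (folding C)
    (fold_config (Mark x) (focus (rev (marks u)) (bits w ++ r))) y.
Proof.
rewrite rev_cat /fold_config (@walk_left _ _ id) => [|l a t]; last first.
  move=> /mapP[b _ ->]; rewrite -/(fold_config _ _) step_folding ?bit_lt5 //.
  by case: b.
rewrite map_id /focus_left -/(fold_config _ _).
case/lastP: u => [|u b]; last first.
  rewrite marks_rcons rev_rcons yields_folding ?marked_lt5 //=.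
  by case: b.
rewrite yields_folding //=.
by apply: yields_tape => //; exact: (same_cells_trail [::] 1).
Qed.

Lemma unmark_all C x (s : seq nat) r y : all (fun a => 0 < a < 5) s ->
  yields (folding C) (fold_config (Unmark x) (focus_left (rev s) r)) y <->
  yields (folding C)
    (Config (encode fold_start (if x then Some (Seek None) else None))
            (focus [::] (map unmark s ++ r))) y.
Proof.
move=> /allP s5; rewrite -[rev s]cats0 /fold_config (@walk_left _ _ unmark) => [|l a t]; last first.
  case/s5/andP => a0 a5; rewrite -/(fold_config _ _) step_folding //=.
  by rewrite eqn0Ngt a0.
rewrite -/(fold_config _ _) yields_folding //=.
by apply: yields_focus => //; exact: (same_cells_trail [::] 1).
Qed.

Lemma word_symbols u w : all (fun a => 0 < a < 5) (marks u ++ bits w).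
Proof. by rewrite all_cat !all_map; apply/andP; split; apply/allP => -[]. Qed.

Lemma unmark_word u w : map unmark (marks u ++ bits w) = bits (u ++ w).
Proof.
by rewrite map_cat /bits map_cat -!map_comp; congr (_ ++ _); apply: eq_map => -[].
Qed.

Lemma test_cons C ph u w c y :
  yields (folding C) (round_config ph u (rcons w c)) y <->
  yields (folding C)
    (fold_config (Test ph)
       (Tape (rev (marks u ++ bits w)) (bit_symbol c) [::])) y.
Proof. by rewrite seek_end bits_rcons -rcons_cat rev_rcons. Qed.

Lemma back_erased C x u w y :
  yields (folding C)
    (fold_config (Back x) (focus_left (rev (marks u ++ bits w)) [:: blank])) y <->
  yields (folding C)
    (fold_config (Mark x) (focus (rev (marks u)) (bits w))) y.
Proof.
by rewrite back_to_mark; apply: yields_focus => //; exact: same_cells_trail _ 1.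
Qed.

Lemma erase_last C ph x u w c y :
  fold_program (Test ph) (bit_symbol c) = (Some (Back x), blank, MoveLeft) ->
  yields (folding C) (round_config ph u (rcons w c)) y <->
  yields (folding C) (fold_config (Mark x) (focus (rev (marks u)) (bits w))) y.
Proof.
by move=> E; rewrite test_cons yields_folding ?bit_lt5 // E back_erased.
Qed.

Lemma mark_first C x u a w y :
  yields (folding C)
    (fold_config (Mark x) (focus (rev (marks u)) (bits (a :: w)))) y <->
  yields (folding C) (round_config (if x then Some a else None) (rcons u a) w) y.
Proof.
rewrite /round_config marks_rcons rev_rcons yields_folding ?bit_lt5 //.
by rewrite /fold_program is_bit_symbol; case: x a => [] [].
Qed.

(** Each round erases the last symbol and marks the first one, so [w] loses two symbols and [u]
    gains one. At the end only marked symbols remain; unmarking them leaves the head where [C]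
    expects its input. *)
Lemma halving C u w y :
  yields (folding C) (round_config None u w) y <->
  yields C (init (u ++ take (size w)./2 w)) y.
Proof.
have [n] := ubnP (size w); elim: n => // n IH in u w *; rewrite ltnS => wn.
have finish (v : bstring) l : same_cells l (rev (marks v)) ->
  yields (folding C) (fold_config (Unmark false) (focus_left l [::])) y <->
  yields C (init v) y.
  move=> lv; transitivity
   (yields (folding C) (fold_config (Unmark false) (focus_left (rev (marks v)) [::])) y).
    apply: yields_focus; first exact: same_cells_behead.
    by move=> [|i] //=; rewrite (same_cells_head lv).
  rewrite -[marks v]cats0 (@unmark_all _ _ (marks v ++ bits [::])) ?word_symbols //.
  rewrite unmark_word !cats0 /=.
  rewrite -(@yields_shift _ fold_start fold_program 5 C (init v)).
  by rewrite /shift_config /= addn0.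
case: w => [|a w] in wn *.
  rewrite [u ++ _]cats0 seek_end cats0 -(finish u (rev (marks u))) //.
  case/lastP: u {finish IH} => [|u b]; first by rewrite yields_folding.
  by rewrite marks_rcons rev_rcons yields_folding ?marked_lt5 //; case: b.
(* For odd length the middle symbol is erased as the last one and nothing is left to mark, whence
   the rounding down. *)
case/lastP: w wn => [|w c] wn.
  rewrite (@erase_last C None false u [::] a); last by case: a {wn}.
  rewrite yields_folding //=.
  rewrite [u ++ _]cats0 -(finish u (rev (marks u))) //.
  rewrite -/(fold_config _ _) -/(focus_left _ _).
  apply: yields_tape => //.
  exact: (same_cells_trail [::] 1).
have -> : u ++ take (size (a :: rcons w c))./2 (a :: rcons w c) =
          rcons u a ++ take (size w)./2 w.
  rewrite cat_rcons /= size_rcons /= -cats1 takel_cat //.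
  by rewrite -[leqRHS]half_double half_leq // -addnn leq_addr.
rewrite -IH; last by move: wn; rewrite /= size_rcons; apply: ltn_trans.
rewrite -rcons_cons (@erase_last C None false) ?mark_first //.
by case: c {wn}.
Qed.

Lemma rcons_nseq (T : Type) n (x : T) : rcons (nseq n x) x = nseq n.+1 x.
Proof. by elim: n => //= n ->. Qed.

Lemma reject_diverges C l a r y : a < 5 ->
  ~ yields (folding C) (fold_config Reject (Tape l a r)) y.
Proof. by move=> a5; apply: loop_diverges; rewrite step_folding. Qed.

(** Zeros disappear in pairs, one erased and one marked, until the machine tests a marked 0 or a
    blank, or has only a blank to mark; each case leads to [Reject]. The hypothesis excludes testing
    a marked 1. *)
Lemma match_zeros C b u e y : (e = 0 -> last false u = false) ->
  ~ yields (folding C) (round_config (Some b) u (nseq e false)) y.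
Proof.
have [n] := ubnP e; elim: n => // n IH in b u e *; rewrite ltnS => en eu.
case: e => [|[|e]] in en eu *.
- rewrite seek_end cats0; case/lastP: u => [|u c] in eu *.
    by rewrite yields_folding //; apply: reject_diverges.
  move: (eu erefl); rewrite last_rcons => ->.
  by rewrite marks_rcons rev_rcons yields_folding //; apply: reject_diverges.
- rewrite (@erase_last C _ true u [::]) // yields_folding //=.
  exact: reject_diverges.
have -> : nseq e.+2 false = rcons (nseq e.+1 false) false by rewrite rcons_nseq.
rewrite (@erase_last C _ true) // mark_first.
by apply: IH => [|_]; [exact: ltnW | rewrite last_rcons].
Qed.

Lemma accept_word C u v y :
  yields (folding C)
    (fold_config (Unmark true)
       (focus_left (rev (marks u ++ bits v)) [:: blank])) y <->
  yields (folding C) (round_config None [::] (u ++ v)) y.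
Proof.
rewrite unmark_all ?word_symbols // unmark_word.
by apply: yields_focus => //; apply: same_cells_trail _ 1.
Qed.

(** The word [b :: rcons v true] holds the digits of [c] from the last matched one on. A round
    removes one trailing zero and advances by one digit, so the digit tested once the zeros are gone
    is the one at index [e]. *)
Lemma matching C b u v e y :
  yields (folding C) (round_config (Some b) u (v ++ true :: nseq e false)) y <->
  nth false (b :: rcons v true) e /\
  yields (folding C) (round_config None [::] (u ++ v)) y.
Proof.
elim: e => [|e IH] in b u v *.
  rewrite cats1 test_cons yields_folding //=; case: b; last first.
    by split=> [H|[]//]; exfalso; apply: reject_diverges H.
  rewrite /= -/(fold_config _ _) -/(focus_left _ _) accept_word.
  by split=> [|[]].
have -> : v ++ true :: nseq e.+1 false = rcons (v ++ true :: nseq e false) false.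
  by rewrite rcons_cat rcons_cons rcons_nseq.
rewrite (@erase_last C _ true) //.
(* With [v] empty, the symbol to be marked is the final 1 itself: it is accepted as [marked true] if
   no zero remains, and otherwise the digits are exhausted. *)
case: v => [|a v]; first last.
  by rewrite mark_first IH cat_rcons.
rewrite mark_first.
have := @match_zeros C true (rcons u true) e y.
rewrite last_rcons.
case: e {IH} => [_|e H]; last by rewrite /= nth_nil; split=> [/H[]|[]].
rewrite seek_end (cats0 (marks _)) marks_rcons rev_rcons yields_folding //=.
rewrite -/(fold_config _ _) -/(focus_left _ _).
rewrite -[marks u]cats0 (accept_word _ u [::]).
by split=> [|[]].
Qed.

Lemma dom_folding C x :
  dom (folding C) x <->
  exists y e, [/\ x = y ++ true :: nseq e false,
    nth false (true :: rcons y true) e & dom C (take (size y)./2 y)].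
Proof.
have start y : computes (folding C) x y <->
    yields (folding C) (round_config (Some true) [::] x) y.
  by rewrite /round_config /fold_config encode_start.
(* Cut the string at its last 1; a string of zeros only is rejected by [match_zeros]. *)
have [[y [e xE]] | x0] : (exists y e, x = y ++ true :: nseq e false) \/
    x = nseq (size x) false.
- elim: x {start} => [|[] x [[y [e xE]]|xE]]; first by right.
  + by left; exists (true :: y), e; rewrite xE.
  + by left; exists [::], (size x); rewrite {1}xE.
  + by left; exists (false :: y), e; rewrite xE.
  + by right; rewrite {1}xE.
- rewrite {1}xE; split=> [[z] | ].
    rewrite -xE => /start; rewrite xE => /matching[ye /halving Cz].
    by exists y, e; split=> //; exists z.
  case=> y' [e' [yE ye [z Cz]]]; exists z; rewrite -xE; apply: (proj2 (start z)).
  by rewrite yE; apply/matching; split=> //; apply/halving.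
split=> [[z /start]|[y [e [xE _ _]]]].
  by rewrite x0 => H; exfalso; apply: match_zeros H.
have := congr1 (fun s => true \in s) x0.
by rewrite /= xE mem_cat mem_head orbT mem_nseq andbF.
Qed.

(** * The machine that maps [code C] to [code V] *)

Definition suffix_code : bstring := code (table fold_start fold_program 5).

(* The mode [m] is the index of the current field of the current instruction;
   the fields 0 and 2 are states, which are increased by [fold_exit]. *)
Definition emit (m : 'I_5) (ob : option bool) : bstring :=
  match ob with
  | Some true => [:: true]
  | Some false =>
      if (m == 0 :> nat) || (m == 2 :> nat) then code_nat fold_exit
      else [:: false]
  | None => suffix_code
  end.

Definition next_mode (m : 'I_5) (b : bool) : 'I_5 := if b then m else ordS m.

(** The state [Emit] carries a position in the emitted string; a uniform bound keeps the state set
    finite. *)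
Definition emit_bound : nat := fold_exit + size suffix_code.

Lemma size_emit m ob : size (emit m ob) <= emit_bound.+1.
Proof.
case: ob => [[]|] //=; last by rewrite leqW // leq_addl.
case: ifP => // _; rewrite /code_nat size_rcons size_nseq ltnS.
exact: leq_addr.
Qed.

Inductive copy_state :=
  | Read of 'I_5 | Skip of 'I_5 & bool | Append of 'I_5 & option bool
  | Emit of 'I_5 & option bool & 'I_emit_bound.+2
  | Return of 'I_5 & option bool | Rewind of 'I_5.

Notation copy_code_type := ('I_5 + 'I_5 * bool + ('I_5 * option bool) +
  ('I_5 * option bool * 'I_emit_bound.+2) + ('I_5 * option bool) + 'I_5)%type.

Definition copy_state_code (s : copy_state) : copy_code_type :=
  match s with
  | Read m => inl (inl (inl (inl (inl m))))
  | Skip m b => inl (inl (inl (inl (inr (m, b)))))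
  | Append m ob => inl (inl (inl (inr (m, ob))))
  | Emit m ob k => inl (inl (inr (m, ob, k)))
  | Return m ob => inl (inr (m, ob))
  | Rewind m => inr m
  end.

Definition copy_state_decode (s : copy_code_type) : copy_state :=
  match s with
  | inl (inl (inl (inl (inl m)))) => Read m
  | inl (inl (inl (inl (inr (m, b))))) => Skip m b
  | inl (inl (inl (inr (m, ob)))) => Append m ob
  | inl (inl (inr (m, ob, k))) => Emit m ob k
  | inl (inr (m, ob)) => Return m ob
  | inr m => Rewind m
  end.

Lemma copy_state_codeK : cancel copy_state_code copy_state_decode.
Proof. by case. Qed.

HB.instance Definition _ := Finite.copy copy_state (can_type copy_state_codeK).

(* The tape is [input blank output]. Each round erases the first symbol of the
   input and appends the corresponding string to the output; when no input is
   left, [suffix_code] is appended. *)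
Definition copy_program : program copy_state := fun s a =>
  match s with
  | Read m => if a == blank then (Some (Append m None), blank, MoveRight)
              else (Some (Skip m (a == bit_symbol true)), blank, MoveRight)
  | Skip m b => if a == blank then (Some (Append m (Some b)), blank, MoveRight)
                else (Some (Skip m b), a, MoveRight)
  | Append m ob => if a == blank then (Some (Emit m ob ord0), blank, Stay)
                   else (Some (Append m ob), a, MoveRight)
  | Emit m ob k =>
      if k < size (emit m ob)
      then (Some (Emit m ob (inord k.+1)),
            bit_symbol (nth false (emit m ob) k), MoveRight)
      else (Some (Return m ob), blank, MoveLeft)
  | Return m ob =>
      if a != blank then (Some (Return m ob), a, MoveLeft)
      else if ob is Some b then (Some (Rewind (next_mode m b)), blank, MoveLeft)
      else (None, blank, MoveRight)
  | Rewind m => if a != blank then (Some (Rewind m), a, MoveLeft)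
                else (Some (Read m), blank, MoveRight)
  end.

Definition copy_start := Read ord0.

Definition copier : turing := table copy_start copy_program 3.

Definition copy_config (s : copy_state) := Config (encode copy_start (Some s)).

Lemma step_copier s l a r : a < 3 ->
  step copier (copy_config s (Tape l a r)) =
  let: (o, b, d) := copy_program s a in
  Some (Config (encode copy_start o) (move_head d (Tape l b r))).
Proof. by move=> a3; apply: (@step_table _ _ _ _ [::]). Qed.

Lemma yields_copier s l a r y : a < 3 ->
  yields copier (copy_config s (Tape l a r)) y <->
  let: (o, b, d) := copy_program s a in
  yields copier (Config (encode copy_start o) (move_head d (Tape l b r))) y.
Proof.
move=> a3; have := step_copier s l r a3.
by case: copy_program => -[tgt b] d; apply: yields_step.
Qed.

Lemma bit_lt3 b : bit_symbol b < 3. Proof. by case: b. Qed.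

Lemma copy_right s w l r y :
  (forall b, copy_program s (bit_symbol b) = (Some s, bit_symbol b, MoveRight)) ->
  yields copier (copy_config s (focus l (bits w ++ r))) y <->
  yields copier (copy_config s (focus (rev (bits w) ++ l) r)) y.
Proof.
move=> sR; apply: walk_right => l' a r' /mapP[b _ ->].
by rewrite -/(copy_config _ _) step_copier ?bit_lt3 // sR.
Qed.

Lemma copy_left s w l r y :
  (forall b, copy_program s (bit_symbol b) = (Some s, bit_symbol b, MoveLeft)) ->
  yields copier (copy_config s (focus_left (rev (bits w) ++ l) r)) y <->
  yields copier (copy_config s (focus_left l (bits w ++ r))) y.
Proof.
move=> sL; rewrite -[bits w in X in _ <-> X]map_id; apply: walk_left => l' a r'.
move=> /mapP[b _ ->].
by rewrite -/(copy_config _ _) step_copier ?bit_lt3 // sL.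
Qed.

Lemma emit_all m ob (k : 'I_emit_bound.+2) l y : k <= size (emit m ob) ->
  yields copier (copy_config (Emit m ob k) (focus l [::])) y <->
  yields copier
    (copy_config (Return m ob)
       (focus_left (rev (bits (drop k (emit m ob))) ++ l) [:: blank])) y.
Proof.
have [n] := ubnP (size (emit m ob) - k); elim: n => // n IH in k l *.
rewrite ltnS => kn; rewrite yields_copier //= leq_eqVlt => /orP[/eqP -> |km].
  by rewrite ltnn drop_size.
rewrite km /= (drop_nth false km) /= rev_cons cat_rcons.
(* The counter stays in range, so [inord] does not fall back to its default. *)
have kE : (inord k.+1 : 'I_emit_bound.+2) = k.+1 :> nat.
  by rewrite inordK // ltnS (leq_trans km) // size_emit.
rewrite -/(copy_config _ _) -/(focus _ [::]) IH kE //.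
by rewrite subnS prednK ?subn_gt0 // (leq_trans _ kn) // subn_gt0.
Qed.

Lemma append_all m ob o l y :
  yields copier (copy_config (Append m ob) (focus l (bits o))) y <->
  yields copier
    (copy_config (Return m ob)
       (focus_left l (bits (o ++ emit m ob) ++ [:: blank]))) y.
Proof.
rewrite -[bits o]cats0 copy_right; last by case.
rewrite yields_copier //= -/(copy_config _ _) -/(focus _ [::]) emit_all //= drop0.
rewrite catA -rev_cat -[bits o ++ _]map_cat copy_left //.
by case.
Qed.

Definition copying m w o := copy_config (Read m) (focus [::] (bits w ++ blank :: bits o)).

Lemma copying_cons m b w o y :
  yields copier (copying m (b :: w) o) y <->
  yields copier (copying (next_mode m b) w (o ++ emit m (Some b))) y.
Proof.
rewrite /copying yields_copier ?bit_lt3 //=.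
have -> : (bit_symbol b == blank) = false by case: b.
have -> : (bit_symbol b == 2) = b by case: b.
rewrite -/(copy_config _ _) -/(focus _ _) copy_right; last by case.
rewrite yields_copier //= -/(copy_config _ _) -/(focus _ _) append_all.
rewrite /focus_left yields_copier //= -/(copy_config _ _) -/(focus_left _ _).
rewrite copy_left; last by case.
rewrite /focus_left yields_copier //= -/(focus _ _).
apply: yields_focus; first exact: (same_cells_trail [::] 1).
rewrite -cat_cons catA; exact: (same_cells_trail _ 1).
Qed.

Lemma copying_nil m o : yields copier (copying m [::] o) (o ++ suffix_code).
Proof.
rewrite /copying yields_copier //= -/(copy_config _ _) -/(focus _ _) append_all.
rewrite /focus_left yields_copier //= -/(focus _ _).
apply/yields_focus; first exact: (fun=> erefl).
  exact: (same_cells_trail _ 1).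
(* The exit is not the source of any instruction: the machine halts with its head on the first cell
   of the output. *)
apply/yields_halted.
  by rewrite /step step_table_exit.
rewrite /output /=; elim: (o ++ _) => //= b w IH.
by case: b; congr (_ :: _); rewrite -[RHS]IH; case: (w).
Qed.

(** The finite-state transducer realized by the copier. *)
Fixpoint transduce (m : 'I_5) (w : bstring) : bstring :=
  if w is b :: w' then emit m (Some b) ++ transduce (next_mode m b) w'
  else suffix_code.

Lemma copying_transduce m w o :
  yields copier (copying m w o) (o ++ transduce m w).
Proof.
elim: w m o => [|b w IH] m o /=; first exact: copying_nil.
by apply/copying_cons; rewrite catA; apply: IH.
Qed.

(** In unary, adding [fold_exit] amounts to writing that many ones before the closing 0, so the
    number itself need not be remembered. *)
Lemma transduce_nat m n w :
  transduce m (code_nat n ++ w) =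
  code_nat (if (m == 0 :> nat) || (m == 2 :> nat) then fold_exit + n else n) ++
  transduce (ordS m) w.
Proof.
elim: n => [|n IH] /=.
  by rewrite addn0; case: ifP.
by rewrite IH; case: ifP => // _; rewrite addnS.
Qed.

Lemma transduce_code C :
  transduce ord0 (code C) = code (map (shift_instr fold_exit) C) ++ suffix_code.
Proof.
elim: C => //= i C IH.
rewrite /code /= -/(code C) /code_instr -!catA !transduce_nat /=.
rewrite -/(code _).
have -> : ordS (ordS (ordS (ordS (ordS ord0)))) = ord0 :> 'I_5 by apply: val_inj.
by rewrite IH /code_move -?catA /= -?catA.
Qed.

Lemma copier_computes C : computes copier (code C) (code (folding C)).
Proof.
have -> : code (folding C) = transduce ord0 (code C).
  by rewrite transduce_code /code map_cat flatten_cat.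
have := copying_transduce ord0 (code C) [::].
rewrite /copying /copy_config encode_start.
(* With empty output, the separating blank is a trailing blank of the initial tape. *)
by apply: (proj1 (yields_focus _ _ _ _ (same_cells_trail _ 1))).
Qed.

(** * The zeta and Omega numbers *)

(** The inverse of [bin]: starting from 1 restores the leading digit. *)
Definition value (x : bstring) : nat := foldl (fun n (b : bool) => n.*2 + b) 1 x.

Lemma value_rcons x b : value (rcons x b) = (value x).*2 + b.
Proof. by rewrite /value foldl_rcons. Qed.

Lemma value_gt0 x : 0 < value x.
Proof.
by elim/last_ind: x => // x b IH; rewrite value_rcons addn_gt0 double_gt0 IH.
Qed.

Lemma value_inj : injective value.
Proof.
have value_rcons_gt1 x b : 1 < value (rcons x b).
  by rewrite value_rcons -addnn ltn_addr // (@leq_add 1 1) ?value_gt0.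
elim/last_ind=> [|x b IH] y; case/lastP: y => [|y c] //.
- by move=> E; have := value_rcons_gt1 y c; rewrite -E.
- by move=> E; have := value_rcons_gt1 x b; rewrite E.
rewrite !value_rcons => E; have bc : b = c.
  by have := congr1 odd E; rewrite !oddD !odd_double !oddb.
by move: E; rewrite bc => /addIn/double_inj/IH ->.
Qed.

Lemma value_bin n : 0 < n -> value (bin n) = n.
Proof.
have numP p : value (bin_pos p) = nat_of_pos p.
  by elim: p => //= p IH; rewrite value_rcons IH ?addn0 ?addn1 NatTrec.doubleE.
move=> n0; have := bin_of_natK n; rewrite /bin.
by case: (bin_of_nat n) => [E|p <-]; [rewrite -E in n0 | exact: numP].
Qed.

Lemma bin_value x : bin (value x) = x.
Proof. by apply: value_inj; rewrite value_bin ?value_gt0. Qed.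

Lemma value_zeros y e : value (y ++ true :: nseq e false) = value (rcons y true) * 2 ^ e.
Proof.
elim: e => [|e IH]; first by rewrite cats1 muln1.
by rewrite -rcons_nseq -rcons_cons -rcons_cat value_rcons IH addn0 -mul2n expnS mulnCA.
Qed.

Lemma last_one_inj y y' e e' :
  y ++ true :: nseq e false = y' ++ true :: nseq e' false -> y = y' /\ e = e'.
Proof.
elim: e e' => [|e IH] [|e'].
- by rewrite !cats1 => /rcons_inj[->].
- by rewrite cats1 -rcons_nseq -rcons_cons -rcons_cat => /rcons_inj[].
- by rewrite cats1 -rcons_nseq -rcons_cons -rcons_cat => /rcons_inj[].
by rewrite -!rcons_nseq -!rcons_cons -!rcons_cat => /rcons_inj[/IH[-> ->]].
Qed.

Local Open Scope classical_set_scope.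
Local Open Scope ring_scope.

(** Appending a bit [b] doubles both numerator and denominator and adds [b] to the numerator, which
    is the new last digit. *)
Lemma sum_digits (R : realType) x :
  \sum_(0 <= i < (size x).+1) (if nth false (true :: x) i then 2 ^- i else 0) =
  (value x)%:R / 2 ^+ size x :> R.
Proof.
elim/last_ind: x => [|x b IH]; first by rewrite big_nat1 /= expr0 invr1 mulr1.
rewrite size_rcons big_nat_recr //= nth_rcons ltnn eqxx.
rewrite (@eq_big_nat _ _ _ _ _ _
    (fun i => if nth false (true :: x) i then 2 ^- i else 0)); last first.
  by move=> [|i] //= il; rewrite nth_rcons (il : (i < size x)%N).
rewrite IH value_rcons natrD -mul2n natrM exprS.
by case: b => /=; field.
Qed.

Lemma esum_seq (R : realType) (T : choiceType) (P : {pred T}) (r : seq T)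
    (f : T -> R) : uniq r -> {subset P <= r} -> (forall i, 0 <= f i) ->
  (\esum_(i in [set` P]) (f i)%:E = (\sum_(i <- r | P i) f i)%:E)%E.
Proof.
move=> ur Pr f0; rewrite esum_fset; first last.
- by move=> i _; rewrite lee_fin.
- by apply: (@sub_finite_set _ _ [set` r]); [move=> i /Pr | exact: finite_seq].
rewrite -sumEFin (@bigfs _ _ _ _ r) // => i /Pr ->.
by [].
Qed.

Lemma esum_exponents (R : realType) y :
  (\esum_(e in [set e | nth false (true :: rcons y true) e])
     ((value (y ++ true :: nseq e false))%:R^-1)%:E =
   (2 ^- (size y).+1 : R)%:E)%E.
Proof.
set c : R := (value (rcons y true))%:R.
have c0 : c != 0 by rewrite pnatr_eq0 -lt0n value_gt0.
under eq_esum do rewrite value_zeros natrM invfM natrX -/c.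
(* The number [c] has [(size y).+2] digits; beyond them [nth] returns [false], so the support is
   finite. *)
rewrite (@esum_seq _ _ (nth false (true :: rcons y true)) (index_iota 0 (size y).+2)).
- congr EFin; rewrite -big_distrr /= big_mkcond /=.
  have := sum_digits R (rcons y true); rewrite size_rcons => ->.
  by rewrite mulKf.
- exact: iota_uniq.
- move=> e; rewrite mem_index_iota /= ltnNge.
  have -> : (e \in nth false (true :: rcons y true)) =
            nth false (true :: rcons y true) e by [].
  by apply: contraL => ye; rewrite nth_default //= size_rcons.
- by move=> i; rewrite mulr_ge0 // invr_ge0 ?exprn_ge0 ?ler0n.
Qed.

Lemma esum_const_size (R : realType) k (c : R) : 0 <= c ->
  (\esum_(r in [set r : bstring | size r = k]) c%:E = (2 ^+ k * c)%:E)%E.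
Proof.
move=> c0; pose words := [seq tval t | t : k.-tuple bool].
rewrite (_ : [set r | _] = [set` words]).
  rewrite (@esum_seq _ _ (mem words) words) //; last first.
    by rewrite map_inj_uniq ?enum_uniq //; exact: val_inj.
  rewrite -big_seq big_const_seq count_predT iter_addr_0 size_map -cardE.
  by rewrite card_tuple card_bool -[c *+ _]mulr_natl natrX.
apply/seteqP; split=> r /=.
  by move=> /eqP rk; apply/mapP; exists (Tuple rk); rewrite ?mem_enum.
by move=> /mapP[t _ ->]; rewrite size_tuple.
Qed.

(** Here [k] is the length of a prefix [p] and [r] completes it to [y], whose weight is 2^-(|y|+1).
    Each of the two possible lengths of [r] contributes 2^-(k+1). *)
Lemma esum_halves (R : realType) k :
  (\esum_(r in [set r : bstring | size r = k \/ size r = k.+1])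
     (2 ^- (k + size r).+1 : R)%:E = (2 ^- k)%:E)%E.
Proof.
rewrite (@esumID _ _ [set r | size r = k]) => [|r _]; last first.
  by rewrite lee_fin invr_ge0 exprn_ge0.
rewrite (_ : _ `&` [set r | _] = [set r | size r = k]); last first.
  by apply/seteqP; split=> r /= => [[]|]; auto.
rewrite (_ : _ `&` ~` _ = [set r | size r = k.+1]); last first.
  apply/seteqP; split=> r /= => [[[]//]|rk].
  by split; [right | rewrite rk => /esym/n_Sn].
under eq_esum => r /= -> do [].
under [X in (_ + X)%E]eq_esum => r /= -> do [].
rewrite !esum_const_size ?invr_ge0 ?exprn_ge0 // -EFinD; congr EFin.
rewrite !addnS !exprS !exprD.
have : 2 ^+ k != 0 :> R by rewrite expf_neq0 // pnatr_eq0.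
by move=> k0; field.
Qed.

Lemma zeta_strings (R : realType) (M : turing) :
  (zeta R M = \esum_(x in dom M) ((value x)%:R^-1 : R)%:E)%E.
Proof.
rewrite /zeta; apply: reindex_esum; split.
- by move=> x /= Mx; rewrite value_gt0 bin_value.
- by move=> x y _ _; exact: value_inj.
- by move=> n [n0 Mn]; exists (bin n) => //; rewrite value_bin.
Qed.

Lemma zeta_folding (R : realType) (C : turing) :
  zeta R (folding C) = Omega R C.
Proof.
pose Y := [set y | dom C (take (size y)./2 y)].
pose E y := [set e | nth false (true :: rcons y true) e].
rewrite zeta_strings.
(* Index the domain by the pairs [(y, e)], then sum over [e] first. *)
rewrite (@reindex_esum _ _ _ (Y `*`` E) _
    (fun k => k.1 ++ true :: nseq k.2 false)); last first.
  split.
  - by move=> [y e] /= [Yy Ee]; apply/dom_folding; exists y, e.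
  - by move=> [y e] [y' e'] _ _ /= /last_one_inj[-> ->].
  - by move=> x /dom_folding[y [e [-> ye Cy]]]; exists (y, e).
rewrite -(@esum_esum _ _ _ Y E
  (fun y e => ((value (y ++ true :: nseq e false))%:R^-1 : R)%:E)); last first.
  by move=> y e _ _; rewrite lee_fin invr_ge0.
under eq_esum do rewrite esum_exponents.
(* Split [y] into its first half [p], rounded down, and the rest [r], then sum over [r] first. *)
rewrite (@reindex_esum _ _ _
    (dom C `*`` (fun p => [set r : bstring | size r = size p \/ size r = (size p).+1])) _
    (fun k => k.1 ++ k.2)); last first.
  have half p (r : bstring) : size r = size p \/ size r = (size p).+1 ->
      (size (p ++ r))./2 = size p.
    by rewrite size_cat => -[] ->; rewrite ?addnS addnn /= ?uphalf_double ?doubleK.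
  split.
  - by move=> [p r] /= [Cp /half rp]; rewrite /Y /= rp take_size_cat.
  - move=> [p r] [p' r'] /set_mem[_ /half rp] /set_mem[_ /half rp'] /= E1.
    move: rp rp'; rewrite /= E1 => -> pp'.
    by move/eqP: E1; rewrite eqseq_cat // => /andP[/eqP-> /eqP->].
  - move=> y Yy; exists (take (size y)./2 y, drop (size y)./2 y).
      split=> //=; rewrite size_drop size_takel; last first.
        by rewrite -[leqRHS]odd_double_half -addnn addnCA leq_addr.
      rewrite -{1 4}[size y]odd_double_half -addnn addnA addnK.
      by case: odd; [right|left].
    by rewrite /= cat_take_drop.
under eq_esum do rewrite size_cat.
rewrite -(@esum_esum _ _ _ (dom C) _
  (fun p r => (2 ^- (size p + size r).+1 : R)%:E)); last first.
  by move=> p r _ _; rewrite lee_fin invr_ge0 exprn_ge0.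
by under eq_esum do rewrite esum_halves.
Qed.

(** * Kraft's inequality *)

Lemma kraft (R : realType) (s : seq bstring) : uniq s ->
  {in s &, forall p q, prefix p q -> p = q} ->
  \sum_(p <- s) 2 ^- size p <= 1 :> R.
Proof.
move=> us pf; have [n sn] : exists n, {in s, forall p, size p < n}%N.
  exists (\max_(p <- s) size p).+1%N => p ps.
  by rewrite ltnS (@leq_bigmax_seq _ _ xpredT size).
(* Induction on a strict length bound: unless the empty string occurs, split by first bit; the tails
   for each bit are again prefix-free and contribute at most 1/2. *)
elim: n s us pf sn => [|n IH] s us pf sn.
  by case: s sn {us pf} => [_|p s /(_ p (mem_head _ _))]; first rewrite big_nil.
have [s0|s0] := boolP ([::] \in s).
  suff -> : s = [:: [::]] by rewrite big_seq1 expr0 invr1.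
  apply: perm_small_eq => //; apply: uniq_perm => // p; rewrite inE.
  by apply/idP/eqP => [ps|-> //]; rewrite -(pf _ _ s0 ps) // prefix0s.
(* As [[::]] is not in [s], the default of [head] is never taken for a first bit. *)
pose tails b := [seq behead p | p <- s & head false p == b].
have tailP b q : (q \in tails b) = (b :: q \in s).
  apply/mapP/idP => [[[|c p]]|qs].
  - by rewrite mem_filter (negbTE s0) andbF.
  - by rewrite mem_filter /= => /andP[/eqP -> ps] ->.
  - by exists (b :: q); rewrite // mem_filter /= eqxx.
have split_sum b : \sum_(p <- s | head false p == b) 2 ^- size p =
    2^-1 * \sum_(q <- tails b) 2 ^- size q :> R.
  rewrite big_map big_filter big_distrr /= [LHS]big_seq_cond [RHS]big_seq_cond.
  apply: eq_bigr => -[|c p] /andP[ps _]; first by rewrite ps in s0.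
  by rewrite /= exprS invfM.
have tail_le b : \sum_(q <- tails b) 2 ^- size q <= 1 :> R.
  apply: IH.
  - rewrite map_inj_in_uniq ?filter_uniq // => p q.
    rewrite !mem_filter => /andP[/eqP pb ps] /andP[/eqP qb qs].
    case: p q pb qb ps qs => [|c p] [|d q] /=; rewrite ?(negbTE s0) //.
    by move=> -> -> _ _ ->.
  - move=> p q; rewrite !tailP => ps qs pq.
    suff: b :: p = b :: q by case.
    by apply: pf; rewrite //= eqxx.
  - by move=> q; rewrite tailP => /sn.
rewrite (bigID (fun p => head false p == true)) /=.
rewrite [X in _ + X](eq_bigl (fun p => head false p == false)) => [|p]; last by case: head.
rewrite !split_sum; have := tail_le true; have := tail_le false.
lra.
Qed.

(** The extended sum is a supremum over finite subsets of the domain, and Kraft's inequality bounds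
    each finite sum. *)
Lemma Omega_le1 (R : realType) (C : turing) :
  self_delimiting C -> (Omega R C <= 1)%E.
Proof.
move=> sd; apply: ge_ereal_sup => _ [X [finX XC] <-].
rewrite fsbig_finite // sumEFin lee_fin; apply: kraft; first exact: finmap.fset_uniq.
by move=> p q; rewrite !in_fset_set // => /set_mem/XC Cp /set_mem/XC Cq; exact: sd.
Qed.

Theorem theorem21 (R : realType) :
  exists T : turing, forall C : turing, self_delimiting C ->
    exists V : turing,
      [/\ computes T (code C) (code V), tuatara R V & zeta R V = Omega R C].
Proof.
exists copier => C sd; exists (folding C); split.
- exact: copier_computes.
- by rewrite /tuatara zeta_folding; exact: Omega_le1.
- exact: zeta_folding.
Qed.
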